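(* Let $G$ be a group with decidable word problem generated by $\Sigma=\{x_1,\dots,x_m,x_1^{-1},\dots,x_m^{-1}\}$, with identity $e$, and let $\mathfrak{L}(G)=\{\omega\in\Sigma^*\mid\omega\equiv e\ (\mathrm{mod}\ G)\}$. Let $L$ be a regular language recognized by a finite automaton $A=(Q,\Sigma,\delta,q_1,Z)$ with $n$ states $Q=\{q_1,\dots,q_n\}$. Then the algorithm described in the context (with input $g_{ij}^0$, $1\le i,j\le n$) correctly checks the inclusion $L\subseteq\mathfrak{L}(G)$: it returns $T=\mathbf{True}$ if $L\subseteq\mathfrak{L}(G)$ and $T=\mathbf{False}$ otherwise. Moreover, it executes at most $O(n^3)$ operations $\cup$ and $\cdot$, and at most $O(n^2)$ operations $\star$, in the semiring $F_G$.
   Context: $\Sigma^*$ is the free monoid over the finite alphabet $\Sigma$; the letter $x_i^{-1}$ represents in $G$ the inverse of the element represented by $x_i$. The automaton may be deterministic or nondeterministic; $q_1$ is the start state, $Z\subseteq Q$ the set of final states, each transition reads one letter of $\Sigma$, and $L=L(A)=\{\omega\in\Sigma^*\mid\delta(q_1,\omega)\cap Z\neq\emptyset\}$. $F_G=(\mathcal{P}(G),\cup,\cdot,\emptyset,\{e\})$ is the semiring of subsets of $G$ with union and elementwise product. For $X,Y\in F_G$, $X\star Y=\{xyx^{-1}\mid x\in X,\ y\in Y\}$. Input: $g_{ij}^0\subseteq G$ is the set of elements of $G$ represented by the letters $a\in\Sigma$ with $q_j\in\delta(q_i,a)$, $1\le i,j\le n$. (Superscripts on $g$ are indices, not exponents.)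 Algorithm: 1. Set $T:=\mathbf{True}$. 2. For $k=1,\dots,n$, and for all $1\le i,j\le n$, set $g_{ij}^k:=g_{ij}^{k-1}\cup g_{ik}^{k-1}\cdot g_{kj}^{k-1}$. 3. For every $j$ with $q_j\in Z$: if $g_{1j}^n\neq\emptyset$ and $g_{1j}^n\neq\{e\}$, set $T:=\mathbf{False}$ and halt. 4. For every $1\le j\le n$ and every $t$ with $q_t\in Z$: if $g_{jt}^n\neq\emptyset$, $g_{1j}^n\neq\emptyset$ and $g_{jj}^n\neq\emptyset$, then, if $g_{1j}^n\star g_{jj}^n\neq\{e\}$, set $T:=\mathbf{False}$ and halt. The output is the final value of $T$. *)

(* Defs.v *)
From mathcomp Require Import all_boot all_fingroup.
From mathcomp Require Import boolp classical_sets.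

Set Implicit Arguments.
Unset Strict Implicit.
Unset Printing Implicit Defensive.

Local Open Scope classical_set_scope.

(** Single-tape Turing machines.  A cell of the two-way infinite tape holds
    [None] (blank), an input letter or an auxiliary symbol.  A machine stops
    when [tm_step] is [None], with verdict [tm_accept]; otherwise the step gives
    the new state, the symbol written and the move of the head ([true] is to
    the right). *)

Record turing_machine (S : finType) := TuringMachine {
  tm_state : finType;
  tm_aux : finType;
  tm_init : tm_state;
  tm_accept : tm_state -> bool;
  tm_step : tm_state -> option (S + tm_aux) ->
            option (tm_state * option (S + tm_aux) * bool)
}.

Section TuringMachines.
Context (S : finType) (M : turing_machine S).

Notation cell := (option (S + tm_aux M))%type.

(** [(q, l, r)]: the head scans the first cell of [r], and [l] lists the cells
    to its left, nearest first; the cells not listed are blank. *)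
Definition tm_config : Type := tm_state M * seq cell * seq cell.

Definition tm_start (w : seq S) : tm_config :=
  (tm_init M, [::], [seq Some (inl a) | a <- w]).

(** The verdict of [M] from configuration [c], if it stops within [k] steps. *)
Fixpoint tm_run (k : nat) (c : tm_config) : option bool :=
  let: (q, l, r) := c in
  match tm_step q (head None r) with
  | None => Some (tm_accept q)
  | Some (q', s, to_right) =>
      if k is k'.+1 then
        tm_run k' (if to_right then (q', s :: l, behead r)
                   else (q', behead l, head None l :: s :: behead r))
      else None
  end.

Definition tm_decides (P : set (seq S)) : Prop :=
  forall w : seq S, exists k : nat,
    (P w /\ tm_run k (tm_start w) = Some true) \/
    (~ P w /\ tm_run k (tm_start w) = Some false).

End TuringMachines.

Definition decidable_language (S : finType) (P : set (seq S)) : Prop :=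
  exists M : turing_machine S, tm_decides M P.

(** [(i, false)] is the letter x_i, and [(i, true)] the letter x_i^-1. *)

Definition letter (m : nat) : finType := ('I_m * bool)%type.

Definition letter_val (G : groupType) (m : nat) (x : 'I_m -> G)
    (a : letter m) : G :=
  if a.2 then ((x a.1)^-1)%g else x a.1.

Definition word_val (G : groupType) (m : nat) (x : 'I_m -> G)
    (w : seq (letter m)) : G :=
  foldr (fun a g => (letter_val x a * g)%g) 1%g w.

Definition generates (G : groupType) (m : nat) (x : 'I_m -> G) : Prop :=
  forall g : G, exists w : seq (letter m), word_val x w = g.

Definition word_problem (G : groupType) (m : nat) (x : 'I_m -> G) :
    set (seq (letter m)) :=
  [set w | word_val x w = 1%g].

(** The states are the elements of ['I_n.+1] and the start state q_1 is [ord0].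
    In a deterministic automaton each [trans q a] has at most one element. *)

Record automaton (S : finType) (n : nat) := Automaton {
  trans : 'I_n.+1 -> S -> {set 'I_n.+1};
  final : {set 'I_n.+1}
}.

Definition trans_word (S : finType) (n : nat) (A : automaton S n)
    (q : 'I_n.+1) (w : seq S) : {set 'I_n.+1} :=
  foldl (fun (X : {set 'I_n.+1}) a => (\bigcup_(p in X) trans A p a)%SET)
        [set q]%SET w.

Definition language (S : finType) (n : nat) (A : automaton S n) :
    set (seq S) :=
  [set w | (trans_word A ord0 w :&: final A != finset.set0)%SET].

(** The semiring F_G is [set G] with [`|`], [set_mul], [set0] and [[set 1]]. *)
Definition set_mul (G : groupType) (X Y : set G) : set G :=
  [set (x * y)%g | x in X & y in Y].

Definition set_star (G : groupType) (X Y : set G) : set G :=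
  [set (x * y * x^-1)%g | x in X & y in Y].

(** A value of [counted T] is a result with the numbers of operations of F_G
    executed to obtain it. *)
Record op_count := OpCount { ncup : nat; nmul : nat; nstar : nat }.

Definition add_count (c d : op_count) : op_count :=
  OpCount (ncup c + ncup d) (nmul c + nmul d) (nstar c + nstar d).

Definition counted (T : Type) : Type := T * op_count.

Definition ret (T : Type) (v : T) : counted T := (v, OpCount 0 0 0).

Definition bind (T U : Type) (p : counted T) (f : T -> counted U) : counted U :=
  let: (v, c) := p in let: (u, d) := f v in (u, add_count c d).

Notation "v <-- p ;; q" := (bind p (fun v => q))
  (at level 61, p at next level, right associativity).

Definition cup_op (G : groupType) (X Y : set G) : counted (set G) :=
  (X `|` Y, OpCount 1 0 0).

Definition mul_op (G : groupType) (X Y : set G) : counted (set G) :=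
  (set_mul X Y, OpCount 0 1 0).

Definition star_op (G : groupType) (X Y : set G) : counted (set G) :=
  (set_star X Y, OpCount 0 0 1).

Fixpoint for_each (I T : Type) (s : seq I) (body : I -> T -> counted T) (v : T) :
    counted T :=
  if s is i :: s' then v' <-- body i v ;; for_each s' body v' else ret v.

(** Runs the tests in order and halts with [false] at the first that fails. *)
Fixpoint check_each (I : Type) (s : seq I) (test : I -> counted bool) :
    counted bool :=
  if s is i :: s' then
    b <-- test i ;; if b then check_each s' test else ret false
  else ret true.

Section Algorithm.
Context (G : groupType) (n : nat).

Definition table : Type := 'I_n.+1 -> 'I_n.+1 -> set G.

Definition set_entry (g : table) (i j : 'I_n.+1) (X : set G) : table :=
  fun i' j' => if (i' == i) && (j' == j) then X else g i' j'.

(** The entries are all computed from the old table [g], not from the table [h]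
    under construction. *)
Definition closure_round (k : 'I_n.+1) (g : table) : counted table :=
  for_each [seq (i, j) | i <- enum 'I_n.+1, j <- enum 'I_n.+1]
    (fun '(i, j) h =>
       Y <-- mul_op (g i k) (g k j) ;;
       X <-- cup_op (g i j) Y ;;
       ret (set_entry h i j X))
    g.

Definition closure_step (g0 : table) : counted table :=
  for_each (enum 'I_n.+1) closure_round g0.

(** The comparisons with [set0] and [[set 1]] are classical; they are effective
    when the word problem is decidable, since the sets that occur are finite. *)
Definition final_step (Z : {set 'I_n.+1}) (g : table) : counted bool :=
  check_each (enum Z)
    (fun j => ret (~~ ((g ord0 j != set0) && (g ord0 j != [set 1%g])))).

Definition loop_step (Z : {set 'I_n.+1}) (g : table) : counted bool :=
  check_each [seq (j, t) | j <- enum 'I_n.+1, t <- enum Z]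
    (fun '(j, t) =>
       if [&& g j t != set0, g ord0 j != set0 & g j j != set0] then
         X <-- star_op (g ord0 j) (g j j) ;; ret (X == [set 1%g])
       else ret true).

Definition algorithm (Z : {set 'I_n.+1}) (g0 : table) : counted bool :=
  g <-- closure_step g0 ;;
  b <-- final_step Z g ;;
  if b then loop_step Z g else ret false.

End Algorithm.

Definition input_table (G : groupType) (m : nat) (x : 'I_m -> G) (n : nat)
    (A : automaton (letter m) n) : table G n :=
  fun i j => [set letter_val x a | a in [set a | j \in trans A i a]].

(* Main.v *)
(** A walk is recorded by the list [s] of its interior states, which may repeat.
    Each round of the closure concatenates only once at the state [k], so the
    final table is not the full transitive closure; but it lies between the
    values of the walks with pairwise distinct interior states and the values of
    all walks.  If the language is contained in the word problem, two accepted
    walks [uw] and [uvw], with [v] a loop, give [u v u^-1 = 1], so all tests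
    succeed.  Conversely, if the tests succeed, the loops with distinct interior
    states at a state lying on an accepted walk have value [1]; cutting loops out
    of an accepted walk keeps its value and leads to distinct interior states,
    where the value is [1] by the tests on the final states. *)

Require Import Defs.
From mathcomp Require Import all_boot all_fingroup.
From mathcomp Require Import boolp classical_sets.

Set Implicit Arguments.
Unset Strict Implicit.
Unset Printing Implicit Defensive.

Local Open Scope classical_set_scope.

(** * Additive costs of counted computations *)

Section Counting.
(** An arbitrary additive measure, so that the same bounds serve for unions and products together
    and for stars alone. *)
Variable f : op_count -> nat.
Hypothesis f0 : f (OpCount 0 0 0) = 0.
Hypothesis fD : forall c d, f (add_count c d) = f c + f d.

Lemma bind1 (T U : Type) (p : counted T) (q : T -> counted U) :
  (bind p q).1 = (q p.1).1.
Proof. by case: p => v c /=; case: (q v). Qed.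

Lemma cost_bind (T U : Type) (p : counted T) (q : T -> counted U) :
  f (bind p q).2 = f p.2 + f (q p.1).2.
Proof. by case: p => v c /=; case: (q v) => u d /=. Qed.

Lemma cost_for_each (I T : Type) (s : seq I) (body : I -> T -> counted T) v b :
  (forall i v, f (body i v).2 <= b) -> f (for_each s body v).2 <= size s * b.
Proof.
move=> hb; elim: s v => [|i s IH] v; first by rewrite /= f0.
by rewrite cost_bind mulSn leq_add ?IH.
Qed.

Lemma cost_check_each (I : Type) (s : seq I) (test : I -> counted bool) b :
  (forall i, f (test i).2 <= b) -> f (check_each s test).2 <= size s * b.
Proof.
move=> hb; elim: s => [|i s IH]; first by rewrite /= f0.
rewrite cost_bind mulSn leq_add //.
by case: ifP => _; rewrite ?f0.
Qed.

End Counting.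

Lemma for_each1 (I T : Type) (s : seq I) (body : I -> T -> counted T) v :
  (for_each s body v).1 = foldl (fun u i => (body i u).1) v s.
Proof. by elim: s v => [|i s IH] v //; rewrite bind1 IH. Qed.

Lemma check_each1 (I : Type) (s : seq I) (test : I -> counted bool) :
  (check_each s test).1 = all (fun i => (test i).1) s.
Proof. by elim: s => [|i s IH] //; rewrite bind1 /= -IH; case: (test i).1. Qed.

Lemma not_uniq_split {T : eqType} (s : seq T) : ~~ uniq s ->
  exists k s1 s2 s3, s = s1 ++ k :: s2 ++ k :: s3.
Proof.
elim: s => [|x s IH] //=; rewrite negb_and negbK.
case/orP=> [/splitPr[s2 s3]|/IH[k [s1 [s2 [s3 ->]]]]].
  by exists x, [::], s2, s3.
by exists k, (x :: s1), s2, s3.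
Qed.

(** * Products and conjugates of subsets of a group *)

Section SetMul.
Variable G : groupType.
Implicit Types X Y W : set G.

Lemma set_mulA X Y W : set_mul X (set_mul Y W) = set_mul (set_mul X Y) W.
Proof.
apply/seteqP; split.
  move=> _ [x Xx [_ [y Yy [z Wz <-]] <-]]; rewrite mulgA.
  by exists (x * y)%g; [exists x => //; exists y|exists z].
move=> _ [_ [x Xx [y Yy <-]] [z Wz <-]]; rewrite -mulgA.
by exists x => //; exists (y * z)%g => //; exists y => //; exists z.
Qed.

Lemma set_mul_neq0 X Y : (set_mul X Y !=set0) <-> X !=set0 /\ Y !=set0.
Proof.
split=> [[_ [x Xx [y Yy _]]]|[[x Xx] [y Yy]]]; first by split; [exists x|exists y].
by exists (x * y)%g; exists x => //; exists y.
Qed.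

(** Only 1 is conjugate to 1. An element of [X] recovers z from its conjugate, and elements of both
    sets show that 1 is attained. *)
Lemma set_star_eq1 X Y : X !=set0 -> Y !=set0 ->
  (set_star X Y = [set 1%g]) <-> (Y `<=` [set 1%g]).
Proof.
move=> [x Xx] [y Yy]; split=> [XY z Yz|Y1].
  have : set_star X Y (x * z * x^-1)%g by exists x => //; exists z.
  rewrite XY /= => /(congr1 (fun u => x^-1 * u * x)%g).
  by rewrite !mulgA mulVg mul1g mulg1 mulVg mulgKV.
apply/seteqP; split=> [_ [u Xu [z /Y1 -> <-]]|_ ->] /=; first by rewrite mulg1 mulgV.
by exists x => //; exists y => //; rewrite (Y1 _ Yy) mulg1 mulgV.
Qed.

End SetMul.

(** * Walks and the cutting of loops *)

Section Walks.
Variables (G : groupType) (n : nat).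
Implicit Types (g : table G n) (i j k : 'I_n.+1) (s r : seq 'I_n.+1).

(** The empty list stands for a single edge, so even a walk from a state to itself has at least one
    edge. *)
Fixpoint walk g i s j : set G :=
  if s is k :: s' then set_mul (g i k) (walk g k s' j) else g i j.

Lemma walk_cat g i s1 k s2 j :
  walk g i (s1 ++ k :: s2) j = set_mul (walk g i s1 k) (walk g k s2 j).
Proof. by elim: s1 i => [|l s1 IH] i //=; rewrite IH set_mulA. Qed.

(** Cutting between two visits to a state shortens the list, and the remaining factors are still
    nonempty. *)
Lemma walk_uniq_neq0 g i s j : walk g i s j !=set0 ->
  exists2 s', uniq s' & walk g i s' j !=set0.
Proof.
have [b] := ubnP (size s); elim: b s => // b IH s; rewrite ltnS => sb w0.
have [us|/not_uniq_split[k [s1 [s2 [s3 es]]]]] := boolP (uniq s); first by exists s.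
subst s; apply: (IH (s1 ++ k :: s3)).
  apply: leq_trans sb; rewrite !size_cat /= size_cat /= ltn_add2l.
  by rewrite !ltnS leq_addl.
move: w0; rewrite !walk_cat !set_mul_neq0; tauto.
Qed.

(** A loop may be cut out when its value is 1, but the hypothesis covers only loops with distinct
    interior states. The induction is therefore applied first to the loop itself, giving one of that
    kind with the same value. *)
Lemma walk_uniq_value g i s j v :
  {in s, forall k s', uniq s' -> walk g k s' k `<=` [set 1%g]} ->
  walk g i s j v -> exists2 s', uniq s' & walk g i s' j v.
Proof.
have [b] := ubnP (size s); elim: b i s j v => // b IH i s j v.
rewrite ltnS => sb triv wv.
have [us|/not_uniq_split[k [s1 [s2 [s3 es]]]]] := boolP (uniq s); first by exists s.
subst s; move: sb; rewrite !size_cat /= size_cat /= => sb.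
move: wv; rewrite !walk_cat => -[u wu [_ [c wc [w ww <-]] <-]].
have [||s2' us2' wc'] := IH k s2 k c _ _ wc.
- by apply: leq_trans sb; apply: leq_trans (leq_addl _ _); rewrite ltnS leq_addr.
- by move=> l ls2; apply: triv; rewrite mem_cat inE mem_cat ls2 !orbT.
have -> : c = 1%g.
  by apply: (triv k _ s2' us2' _ wc'); rewrite mem_cat inE eqxx orbT.
rewrite mul1g; apply: (IH i (s1 ++ k :: s3)).
- by apply: leq_trans sb; rewrite size_cat /= ltn_add2l !ltnS leq_addl.
- move=> l; rewrite mem_cat inE => lin; apply: triv.
  by rewrite mem_cat !inE mem_cat inE; case/or3P: lin => ->; rewrite ?orbT.
- by rewrite walk_cat; exists u => //; exists w.
Qed.

(** * The rounds of the closure *)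

Lemma closure_round1 k g i j :
  (closure_round k g).1 i j = g i j `|` set_mul (g i k) (g k j).
Proof.
rewrite /closure_round for_each1.
have : (i, j) \in [seq (i, j) | i <- enum 'I_n.+1, j <- enum 'I_n.+1].
  by apply/allpairsP; exists (i, j); rewrite !mem_enum.
set F := (X in foldl X).
have FE h p : (F h p) i j =
    if (i, j) == p then g i j `|` set_mul (g i k) (g k j) else h i j.
  case: p => a b; rewrite /F !bind1 /= /set_entry -[(_, _) == _]/(_ && _).
  by case: ifP => // /andP[/eqP -> /eqP ->].
(* Every write takes its value from [g], so for any list containing the pair the entry ends with the
   same value, whatever the order. *)
move: [seq _ | _ <- _, _ <- _] => r.
elim/last_ind: r => // r p IH; rewrite foldl_rcons FE mem_rcons inE.
by case: eqP.
Qed.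

(** An arbitrary list of pivots allows induction on the rounds. *)
Definition closure_rounds r g : table G n :=
  foldl (fun h k => (closure_round k h).1) g r.

Lemma closure_rounds_rcons r k g i j (h := closure_rounds r g) :
  closure_rounds (rcons r k) g i j = h i j `|` set_mul (h i k) (h k j).
Proof. by rewrite /closure_rounds foldl_rcons closure_round1. Qed.

Lemma closure_rounds_sub r g i j v :
  closure_rounds r g i j v -> exists s, walk g i s j v.
Proof.
elim/last_ind: r i j v => [|r k IH] i j v; first by exists [::].
rewrite closure_rounds_rcons => -[/IH //|[x /IH[s1 w1] [y /IH[s2 w2] <-]]].
by exists (s1 ++ k :: s2); rewrite walk_cat; exists x => //; exists y.
Qed.

(** The invariant of Warshall's algorithm: the last pivot [k] occurs at most once in [s], so a
    single concatenation at [k] joins two walks through earlier pivots. *)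
Lemma sub_closure_rounds r g i s j : uniq s -> {subset s <= r} ->
  walk g i s j `<=` closure_rounds r g i j.
Proof.
elim/last_ind: r i s j => [|r k IH] i s j us sr.
  case: s us sr => [|l s] _ sr; first by move=> v.
  by have := sr l (mem_head _ _).
have shrink s' : k \notin s' -> {subset s' <= rcons r k} -> {subset s' <= r}.
  move=> ks' s'r l ls'; have := s'r l ls'; rewrite mem_rcons inE.
  by case: eqP => // lk; rewrite -lk ls' in ks'.
rewrite closure_rounds_rcons.
have [ks|ks] := boolP (k \in s); last first.
  by move=> v wv; left; apply: IH wv => //; apply: shrink.
case/splitPr: ks us sr => s1 s2; rewrite -cat_rcons cat_uniq rcons_uniq.
case/and3P=> /andP[ks1 us1] /hasPn s12 us2 sr.
rewrite cat_rcons walk_cat => _ [x w1 [y w2 <-]]; right.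
exists x; [apply: IH w1|exists y => //; apply: IH w2] => //.
  by apply: shrink => // l ls1; apply: sr; rewrite mem_cat mem_rcons inE ls1 orbT.
apply: shrink => [|l ls2]; last by apply: sr; rewrite mem_cat ls2 orbT.
by apply/negP => /s12; rewrite /= mem_rcons mem_head.
Qed.

Lemma closure_step1 g : (closure_step g).1 = closure_rounds (enum 'I_n.+1) g.
Proof. exact: for_each1. Qed.

Lemma closure_step_sub g i j v :
  (closure_step g).1 i j v -> exists s, walk g i s j v.
Proof. by rewrite closure_step1 => /closure_rounds_sub. Qed.

Lemma sub_closure_step g i s j : uniq s ->
  walk g i s j `<=` (closure_step g).1 i j.
Proof.
by move=> us; rewrite closure_step1; apply: sub_closure_rounds => // l; rewrite mem_enum.
Qed.

(** Nonemptiness is captured exactly, since cutting loops preserves it whatever their values. *)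
Lemma closure_step_neq0 g i j :
  (closure_step g).1 i j !=set0 <-> exists s, walk g i s j !=set0.
Proof.
split=> [[v /closure_step_sub[s w]]|[s /walk_uniq_neq0[s' us' [v w]]]].
  by exists s, v.
by exists v; apply: sub_closure_step w.
Qed.

(** * Correctness of the tests *)

Lemma algorithm1 (Z : {set 'I_n.+1}) g :
  (algorithm Z g).1 <->
  {in Z, forall t s, walk g ord0 s t `<=` [set 1%g]}.
Proof.
rewrite /algorithm !bind1; set h := (closure_step g).1.
have -> : (if (final_step Z h).1 then loop_step Z h else ret false).1
          = (final_step Z h).1 && (loop_step Z h).1 by case: (final_step _ _).1.
rewrite /final_step /loop_step !check_each1; split; last first.
  move=> L1; apply/andP; split; apply/allP.
    move=> t; rewrite mem_enum => Zt /=; rewrite negb_and !negbK.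
    have [->|/set0P[v hv]] := eqVneq (h ord0 t) set0; first by [].
    apply/eqP/seteqP; split=> [u /closure_step_sub[s /(L1 t Zt)]|_ ->] //.
    by have [s /(L1 t Zt) /= <-] := closure_step_sub hv.
  move=> _ /allpairsP[[j t] /= [_ Zt ->]]; rewrite mem_enum in Zt.
  case: ifP => // /and3P[/set0P[w hw] /set0P h0 /set0P hl].
  apply/eqP/set_star_eq1 => // v /closure_step_sub[s2 wv] /=.
  case: h0 => u /closure_step_sub[s1 wu].
  have [s3 ww] := closure_step_sub hw.
  have uw : (u * w = 1)%g.
    by apply: (L1 t Zt (s1 ++ j :: s3)); rewrite walk_cat; exists u => //; exists w.
  have : (u * (v * w) = 1)%g.
    apply: (L1 t Zt (s1 ++ j :: s2 ++ j :: s3)); rewrite !walk_cat.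
    by exists u => //; exists (v * w)%g => //; exists v => //; exists w.
  (* Cancelling u and w in u v w = u w leaves v = 1. *)
  by move=> uvw; apply: (mulIg w); apply: (mulgI u); rewrite mul1g uw.
case/andP=> /allP final1 /allP loop1 t Zt s v wv.
(* A state [k] of the walk is reached from the start and leads to [t], so a loop at [k] makes all
   three guards true and the test at [(k, t)] applies. *)
have triv : {in s, forall k s', uniq s' -> walk g k s' k `<=` [set 1%g]}.
  move=> k ks s' us' c wc.
  case/splitPr: ks wv => s1 s3; rewrite walk_cat => wv.
  have [w1 w3] : walk g ord0 s1 k !=set0 /\ walk g k s3 t !=set0.
    by apply/set_mul_neq0; exists v.
  have h1 : h ord0 k !=set0 by apply/closure_step_neq0; exists s1.
  have h2 : h k k !=set0 by apply/closure_step_neq0; exists s', c.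
  have h3 : h k t !=set0 by apply/closure_step_neq0; exists s3.
  have /loop1 : (k, t) \in [seq (j, t) | j <- enum 'I_n.+1, t <- enum Z].
    by apply/allpairsP; exists (k, t); rewrite !mem_enum.
  move: (h1) (h2) (h3) => /set0P -> /set0P -> /set0P -> /=.
  move=> /eqP /set_star_eq1; apply=> //.
  exact: sub_closure_step wc.
have [s' us' /(sub_closure_step us') hv] := walk_uniq_value triv wv.
have /final1 : t \in enum Z by rewrite mem_enum.
rewrite /= negb_and !negbK -/h => /orP[]/eqP h0; by rewrite -/h h0 in hv.
Qed.

(** Here [b] bounds the cost of one entry, which takes one product and one union. *)
Lemma closure_step_cost (f : op_count -> nat) (b : nat) g :
  f (OpCount 0 0 0) = 0 -> (forall c d, f (add_count c d) = f c + f d) ->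
  f (OpCount 0 1 0) + f (OpCount 1 0 0) <= b ->
  f (closure_step g).2 <= b * n.+1 ^ 3.
Proof.
move=> f0 fD fb.
have -> : b * n.+1 ^ 3 = size (enum 'I_n.+1) *
    (size (enum 'I_n.+1) * size (enum 'I_n.+1) * b).
  by rewrite size_enum_ord mulnC !expnS expn0 muln1 !mulnA.
apply: cost_for_each => // k h; rewrite -(size_allpairs pair).
apply: cost_for_each => // -[i j] u.
by rewrite !cost_bind //= f0 addn0.
Qed.

End Walks.

(** * Accepted words as walks *)

Section Language.
Variables (G : groupType) (m : nat) (x : 'I_m -> G).
Variables (n : nat) (A : automaton (letter m) n).

Lemma trans_word_rcons q w a j :
  (j \in trans_word A q (rcons w a)) =
  [exists k, (k \in trans_word A q w) && (j \in trans A k a)].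
Proof.
rewrite /trans_word foldl_rcons.
by apply/bigcupP/exists_inP => -[k kw jk]; exists k.
Qed.

Lemma word_val_rcons w a : word_val x (rcons w a) = (word_val x w * letter_val x a)%g.
Proof. by elim: w => [|b w IH] /=; rewrite ?mul1g ?mulg1 // IH mulgA. Qed.

Lemma trans_word_walk q w a j : j \in trans_word A q (rcons w a) ->
  exists s, walk (input_table x A) q s j (word_val x (rcons w a)).
Proof.
elim/last_ind: w a j => [|w b IH] a j; rewrite trans_word_rcons.
  case/exists_inP=> k; rewrite inE => /eqP -> ja.
  by exists [::]; exists a => //=; rewrite mulg1.
case/exists_inP=> k /IH[s ws] ja; exists (rcons s k).
rewrite -cats1 walk_cat word_val_rcons.
by exists (word_val x (rcons w b)) => //; exists (letter_val x a) => //; exists a.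
Qed.

Lemma walk_trans_word q s j v : walk (input_table x A) q s j v ->
  exists2 w, j \in trans_word A q w & word_val x w = v.
Proof.
elim/last_ind: s j v => [|s k IH] j v.
  case=> a ja <-; exists [:: a]; last by rewrite /= mulg1.
  by rewrite (trans_word_rcons q [::]); apply/exists_inP; exists q => //; rewrite inE.
rewrite -cats1 walk_cat => -[u /IH[w kw <-] [_ [a ja <-] <-]].
exists (rcons w a); last exact: word_val_rcons.
by rewrite trans_word_rcons; apply/exists_inP; exists k.
Qed.

Lemma language_sub_word_problem :
  language A `<=` word_problem x <->
  {in final A, forall t s, walk (input_table x A) ord0 s t `<=` [set 1%g]}.
Proof.
split=> [LW t Zt s v /walk_trans_word[w tw <-]|L1 w].
  by apply: LW; apply/finset.set0Pn; exists t; rewrite inE tw.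
case/finset.set0Pn=> t; rewrite inE => /andP[tw Zt].
(* The empty word corresponds to no walk, but its value is 1 by definition. *)
case/lastP: w tw => [|w a] tw //.
by have [s /(L1 t Zt)] := trans_word_walk tw.
Qed.

End Language.

(** * Operation counts and the theorem *)

Lemma algorithm_cost (G : groupType) (n : nat) (Z : {set 'I_n.+1}) (g : table G n)
    (f : op_count -> nat) (b3 b2 : nat) :
  f (OpCount 0 0 0) = 0 -> (forall c d, f (add_count c d) = f c + f d) ->
  f (OpCount 0 1 0) + f (OpCount 1 0 0) <= b3 -> f (OpCount 0 0 1) <= b2 ->
  f (algorithm Z g).2 <= b3 * n.+1 ^ 3 + b2 * n.+1 ^ 2.
Proof.
move=> f0 fD fb3 fb2; rewrite !cost_bind // leq_add ?closure_step_cost //.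
set h := (closure_step g).1.
have -> : f (final_step Z h).2 = 0.
  apply/eqP; rewrite -leqn0 -(muln0 (size (enum Z))).
  by apply: cost_check_each => // i; rewrite f0.
case: ifP => _; last by rewrite f0.
have szZ : size (enum Z) <= n.+1 by rewrite -cardE -[leqRHS]card_ord max_card.
(* At most one star is executed for each pair of a state and a final state. *)
apply: (@leq_trans (n.+1 * size (enum Z) * b2)); last first.
  by rewrite mulnC leq_mul2l -mulnn leq_mul2l szZ !orbT.
rewrite -{1}(size_enum_ord n.+1) -(size_allpairs pair).
apply: cost_check_each => // -[j t].
by case: ifP => _; rewrite ?cost_bind //= f0 ?addn0.
Qed.

Theorem theorem2p2 :
  exists c3 c2 : nat,
  forall (G : groupType) (m : nat) (x : 'I_m -> G)
    (hgen : generates x) (hdec : decidable_language (word_problem x))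
    (n : nat) (A : automaton (letter m) n),
    let: (T, cost) := algorithm (final A) (input_table x A) in
    [/\ language A `<=` word_problem x -> T = true,
        ~ (language A `<=` word_problem x) -> T = false,
        ncup cost + nmul cost <= c3 * n.+1 ^ 3 &
        nstar cost <= c2 * n.+1 ^ 2].
Proof.
(* One product and one union per entry and round give 2; one star per tested pair gives 1. *)
exists 2, 1 => G m x _ _ n A.
have correct := algorithm1 (final A) (input_table x A).
have cost := @algorithm_cost _ _ (final A) (input_table x A).
have cupmul := cost (fun c => ncup c + nmul c) 2 0 erefl.
have star := cost nstar 0 1 erefl.
case: (algorithm _ _) correct cupmul star => T c /= correct cupmul star.
split.
- by move/language_sub_word_problem/correct.
- by move=> nLW; apply/negP => /correct/language_sub_word_problem.
- by rewrite -[leqRHS]addn0; apply: cupmul => // c1 c2; rewrite addnACA.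
- exact: star.
Qed.
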